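(* Suppose $X$ is a (crisp) locally crisply discrete type and $x :: X$ is a crisp element. Then $\mathsf{BAut}_X(x) :\equiv \sum_{y : X} \lVert x = y\rVert$ is (crisply) discrete.
   Context: Work in Shulman's Real Cohesive Homotopy Type Theory: HoTT with an additional class of crisp variables, written $a :: A$ (a hypothesis that may be used ''discontinuously''). An expression is crisp if all its free variables are crisp; the type of a crisp variable must be crisp, and only crisp expressions may be substituted for crisp variables. For a crisp type $X$ there is a type $\flat X$ inductively generated by elements $x^{\flat}$ for crisp $x :: X$ (given $C : \flat X\to\mathsf{Type}$ and $f(u):C(u^\flat)$ for crisp $u::X$, one gets an element of $C(v)$ for all $v:\flat X$, computing to $f(u)$ on $u^\flat$), with counit $(-)_{\flat} : \flat X \to X$, $(x^\flat)_\flat \equiv x$. (The theory also has the codiscrete modality $\sharp$, right adjoint to $\flat$.) A crisp type $X$ is crisply discrete if $(-)_{\flat} : \flat X \to X$ is an equivalence. A type $X$ is discrete if the inclusion of constant paths $X \to (\mathbb{R}\to X)$ is an equivalence, $\mathbb{R}$ being the Dedekind reals. Axioms: crisp excluded middle ($P\vee\neg P$ for crisp propositions $P$), and Axiom $\mathbb{R}\flat$: a crisp type is crisply discrete iff it is discrete. A crisp type $X$ is locally crisply discrete if for all crisp $x, y :: X$ the type $x = y$ is crisply discrete; more explicitly, for all $x,y:\flat X$, $x_\flat = y_\flat$ is crisply discrete. $\lVert-\rVert$ is propositional truncation. *)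

(* Defs.v *)
(* Real-cohesive homotopy type theory as a deductive system over raw de Bruijn
   terms: homotopy type theory with a predicative hierarchy of universes, crisp
   and cohesive variables, the modalities flat and sharp, univalence, crisp
   excluded middle, and the axiom that crisply discrete = discrete for crisp types. *)

From Stdlib Require Import List.
Import ListNotations.

(** * Raw syntax *)

(* The number of variables bound in an argument is given where it is nonzero. *)
Inductive tm : Type :=
| Var (n : nat)
| Univ (i : nat)
| Pi (A B : tm)                    (* B: 1 *)
| Lam (A b : tm)                   (* b: 1 *)
| App (f a : tm)
| Sig (A B : tm)                   (* B: 1 *)
| Pair (a b : tm)
| Split (C b p : tm)               (* C: 1, b: 2 *)
| Empty
| EmptyInd (C t : tm)              (* C: 1 *)
| Unit
| Star
| UnitInd (C b t : tm)             (* C: 1 *)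
| Sum (A B : tm)
| Inl (a : tm)
| Inr (b : tm)
| Case (C l r t : tm)              (* C: 1, l: 1, r: 1 *)
| Nat
| Zero
| Suc (n : tm)
| NatInd (C z s n : tm)            (* C: 1, s: 2 (predecessor, then hypothesis) *)
| Id (A a b : tm)
| Refl (a : tm)
| J (C d a b p : tm)               (* C: 3 (both endpoints, then path), d: 1 *)
| Tr (A : tm)                      (* propositional truncation *)
| TrI (a : tm)
| TrP (a b : tm)
| TrRec (B h f t : tm)
| Flat (A : tm)
| FlatI (a : tm)
| FlatE (C N M : tm)               (* C: 1, N: 1; "let u^flat := M in N" *)
| Sharp (A : tm)
| SharpI (a : tm)
| SharpE (a : tm)
| UA (i : nat)
| LEM (P h : tm)
| RFlat (X : tm).

Definition up_ren (r : nat -> nat) (n : nat) : nat :=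
  match n with 0 => 0 | S n => S (r n) end.

Fixpoint ren (r : nat -> nat) (t : tm) : tm :=
  let r1 := up_ren r in
  let r2 := up_ren r1 in
  let r3 := up_ren r2 in
  match t with
  | Var n => Var (r n)
  | Univ i => Univ i
  | Pi A B => Pi (ren r A) (ren r1 B)
  | Lam A b => Lam (ren r A) (ren r1 b)
  | App f a => App (ren r f) (ren r a)
  | Sig A B => Sig (ren r A) (ren r1 B)
  | Pair a b => Pair (ren r a) (ren r b)
  | Split C b p => Split (ren r1 C) (ren r2 b) (ren r p)
  | Empty => Empty
  | EmptyInd C t => EmptyInd (ren r1 C) (ren r t)
  | Unit => Unit
  | Star => Star
  | UnitInd C b t => UnitInd (ren r1 C) (ren r b) (ren r t)
  | Sum A B => Sum (ren r A) (ren r B)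
  | Inl a => Inl (ren r a)
  | Inr b => Inr (ren r b)
  | Case C a b t => Case (ren r1 C) (ren r1 a) (ren r1 b) (ren r t)
  | Nat => Nat
  | Zero => Zero
  | Suc n => Suc (ren r n)
  | NatInd C z s n => NatInd (ren r1 C) (ren r z) (ren r2 s) (ren r n)
  | Id A a b => Id (ren r A) (ren r a) (ren r b)
  | Refl a => Refl (ren r a)
  | J C d a b p => J (ren r3 C) (ren r1 d) (ren r a) (ren r b) (ren r p)
  | Tr A => Tr (ren r A)
  | TrI a => TrI (ren r a)
  | TrP a b => TrP (ren r a) (ren r b)
  | TrRec B h f t => TrRec (ren r B) (ren r h) (ren r f) (ren r t)
  | Flat A => Flat (ren r A)
  | FlatI a => FlatI (ren r a)
  | FlatE C N M => FlatE (ren r1 C) (ren r1 N) (ren r M)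
  | Sharp A => Sharp (ren r A)
  | SharpI a => SharpI (ren r a)
  | SharpE a => SharpE (ren r a)
  | UA i => UA i
  | LEM P h => LEM (ren r P) (ren r h)
  | RFlat X => RFlat (ren r X)
  end.

Definition shift (k n : nat) : nat := k + n.
Definition wk (k : nat) (t : tm) : tm := ren (shift k) t.

Definition scons (a : tm) (s : nat -> tm) (n : nat) : tm :=
  match n with 0 => a | S n => s n end.
Definition vars (k n : nat) : tm := Var (k + n).
Definition up (s : nat -> tm) : nat -> tm :=
  scons (Var 0) (fun n => wk 1 (s n)).

Fixpoint subst (s : nat -> tm) (t : tm) : tm :=
  let s1 := up s in
  let s2 := up s1 in
  let s3 := up s2 in
  match t with
  | Var n => s n
  | Univ i => Univ i
  | Pi A B => Pi (subst s A) (subst s1 B)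
  | Lam A b => Lam (subst s A) (subst s1 b)
  | App f a => App (subst s f) (subst s a)
  | Sig A B => Sig (subst s A) (subst s1 B)
  | Pair a b => Pair (subst s a) (subst s b)
  | Split C b p => Split (subst s1 C) (subst s2 b) (subst s p)
  | Empty => Empty
  | EmptyInd C t => EmptyInd (subst s1 C) (subst s t)
  | Unit => Unit
  | Star => Star
  | UnitInd C b t => UnitInd (subst s1 C) (subst s b) (subst s t)
  | Sum A B => Sum (subst s A) (subst s B)
  | Inl a => Inl (subst s a)
  | Inr b => Inr (subst s b)
  | Case C a b t => Case (subst s1 C) (subst s1 a) (subst s1 b) (subst s t)
  | Nat => Nat
  | Zero => Zero
  | Suc n => Suc (subst s n)
  | NatInd C z u n => NatInd (subst s1 C) (subst s z) (subst s2 u) (subst s n)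
  | Id A a b => Id (subst s A) (subst s a) (subst s b)
  | Refl a => Refl (subst s a)
  | J C d a b p => J (subst s3 C) (subst s1 d) (subst s a) (subst s b) (subst s p)
  | Tr A => Tr (subst s A)
  | TrI a => TrI (subst s a)
  | TrP a b => TrP (subst s a) (subst s b)
  | TrRec B h f t => TrRec (subst s B) (subst s h) (subst s f) (subst s t)
  | Flat A => Flat (subst s A)
  | FlatI a => FlatI (subst s a)
  | FlatE C N M => FlatE (subst s1 C) (subst s1 N) (subst s M)
  | Sharp A => Sharp (subst s A)
  | SharpI a => SharpI (subst s a)
  | SharpE a => SharpE (subst s a)
  | UA i => UA i
  | LEM P h => LEM (subst s P) (subst s h)
  | RFlat X => RFlat (subst s X)
  end.

Infix "⋅" := scons (at level 30, right associativity).
Notation "t [[ s ]]" := (subst s t) (at level 2, left associativity).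

(** * Types defined in the object theory *)

Definition arrow (A B : tm) : tm := Pi A (wk 1 B).
Definition prod (A B : tm) : tm := Sig A (wk 1 B).
Definition neg (A : tm) : tm := arrow A Empty.
Definition iff (A B : tm) : tm := prod (arrow A B) (arrow B A).
Definition or (A B : tm) : tm := Tr (Sum A B).
Definition ex (A B : tm) : tm := Tr (Sig A B).

Definition isProp (A : tm) : tm :=
  Pi A (Pi (wk 1 A) (Id (wk 2 A) (Var 1) (Var 0))).

(* Bi-invertible maps: a right inverse and a left inverse. *)
Definition isEquiv (A B f : tm) : tm :=
  prod
    (Sig (arrow B A)
       (Pi (wk 1 B) (Id (wk 2 B) (App (wk 2 f) (App (Var 1) (Var 0))) (Var 0))))
    (Sig (arrow B A)
       (Pi (wk 1 A) (Id (wk 2 A) (App (Var 1) (App (wk 2 f) (Var 0))) (Var 0)))).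

Definition Equiv (A B : tm) : tm :=
  Sig (arrow A B) (isEquiv (wk 1 A) (wk 1 B) (Var 0)).

Definition idEquiv (A : tm) : tm :=
  let inv := Pair (Lam A (Var 0)) (Lam A (Refl (Var 0))) in
  Pair (Lam A (Var 0)) (Pair inv inv).

Definition idtoEquiv (i : nat) (A B : tm) : tm :=
  Lam (Id (Univ i) A B)
    (J (Equiv (Var 2) (Var 1)) (idEquiv (Var 0)) (wk 1 A) (wk 1 B) (Var 0)).

(** ** Rational numbers *)

Definition add (m n : tm) : tm := NatInd Nat n (Suc (Var 0)) m.
Definition mul (m n : tm) : tm := NatInd Nat Zero (add (wk 2 n) (Var 0)) m.
Definition ltNat (m n : tm) : tm :=
  Sig Nat (Id Nat (add (wk 1 m) (Suc (Var 0))) (wk 1 n)).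

Definition coprime (m n : tm) : tm :=
  Pi Nat (Pi Nat (Pi Nat
    (arrow (Id Nat (mul (Var 2) (Var 1)) (wk 3 m))
       (arrow (Id Nat (mul (Var 2) (Var 0)) (wk 3 n))
          (Id Nat (Var 2) (Suc Zero)))))).

(* Reduced fractions: (n, m, k, _) stands for (n - m) / (k + 1), where n * m = 0
   and n + m is coprime to k + 1. *)
Definition Rat : tm :=
  Sig Nat (Sig Nat (Sig Nat
    (prod (Id Nat (mul (Var 2) (Var 1)) Zero)
       (coprime (add (Var 2) (Var 1)) (Suc (Var 0)))))).

Definition posPart (q : tm) : tm := Split Nat (Var 1) q.
Definition negPart (q : tm) : tm := Split Nat (Split Nat (Var 1) (Var 0)) q.
Definition den (q : tm) : tm :=
  Suc (Split Nat (Split Nat (Split Nat (Var 1) (Var 0)) (Var 0)) q).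

Definition ltRat (q r : tm) : tm :=
  ltNat (add (mul (posPart q) (den r)) (mul (negPart r) (den q)))
        (add (mul (posPart r) (den q)) (mul (negPart q) (den r))).

(** ** Dedekind real numbers *)

Definition Omega : tm := Sig (Univ 0) (isProp (Var 0)).

Definition holds (L q : tm) : tm := Split (Univ 0) (Var 1) (App L q).

Definition inhabitedCut (L U : tm) : tm :=
  prod (ex Rat (holds (wk 1 L) (Var 0))) (ex Rat (holds (wk 1 U) (Var 0))).

Definition roundedCut (L U : tm) : tm :=
  prod
    (Pi Rat (iff (holds (wk 1 L) (Var 0))
       (ex Rat (prod (ltRat (Var 1) (Var 0)) (holds (wk 2 L) (Var 0))))))
    (Pi Rat (iff (holds (wk 1 U) (Var 0))
       (ex Rat (prod (ltRat (Var 0) (Var 1)) (holds (wk 2 U) (Var 0)))))).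

Definition disjointCut (L U : tm) : tm :=
  Pi Rat (neg (prod (holds (wk 1 L) (Var 0)) (holds (wk 1 U) (Var 0)))).

Definition locatedCut (L U : tm) : tm :=
  Pi Rat (Pi Rat (arrow (ltRat (Var 1) (Var 0))
    (or (holds (wk 2 L) (Var 1)) (holds (wk 2 U) (Var 0))))).

Definition isCut (L U : tm) : tm :=
  prod (inhabitedCut L U)
    (prod (roundedCut L U) (prod (disjointCut L U) (locatedCut L U))).

Definition Real : tm :=
  Sig (arrow Rat Omega) (Sig (arrow Rat Omega) (isCut (Var 1) (Var 0))).

(** ** Discreteness *)

Definition counit (X : tm) : tm :=
  Lam (Flat X) (FlatE (wk 2 X) (Var 0) (Var 0)).

Definition isCrisplyDiscrete (X : tm) : tm := isEquiv (Flat X) X (counit X).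

Definition constPath (X : tm) : tm := Lam X (Lam Real (Var 1)).

Definition isDiscrete (X : tm) : tm := isEquiv X (arrow Real X) (constPath X).

(* For X in Univ i: for all x, y in flat X, let a^flat := x and b^flat := y in
   "a = b is crisply discrete". *)
Definition isLocallyCrisplyDiscrete (i : nat) (X : tm) : tm :=
  Pi (Flat X) (Pi (Flat (wk 1 X))
    (FlatE (Univ i)
       (FlatE (Univ i)
          (isCrisplyDiscrete (Id (wk 4 X) (Var 1) (Var 0)))
          (Var 1))
       (Var 1))).

Definition BAut (X x : tm) : tm := Sig X (Tr (Id (wk 1 X) (wk 1 x) (Var 0))).

(** * Contexts *)

(* A context carries a mode for each variable instead of being split into a crisp
   and a cohesive zone; [hidden] variables may not be used at all.  They arise when
   the cohesive zone is discarded, and keep de Bruijn indices unchanged. *)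
Inductive mode : Type := crisp | cohesive | hidden.

Definition ctx : Type := list (mode * tm).

(* The passage from Delta | Gamma to Delta | (empty). *)
Definition only_crisp (G : ctx) : ctx :=
  map (fun d => (match fst d with crisp => crisp | _ => hidden end, snd d)) G.

(* The passage from Delta | Gamma to Delta, Gamma | (empty). *)
Definition all_crisp (G : ctx) : ctx :=
  map (fun d => (match fst d with hidden => hidden | _ => crisp end, snd d)) G.

Notation "G ,, A" := (cons (cohesive, A) G) (at level 61, left associativity).
Notation "G ,,♭ A" := (cons (crisp, A) G) (at level 61, left associativity).

(** * Derivations *)

(* The single judgment is typed judgmental equality; the typing judgment is its
   diagonal, so each rule other than computation, uniqueness, symmetry and
   transitivity is at once a typing rule and the matching congruence rule.  The
   context is presupposed to be well formed: every entry is a type in the context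
   that precedes it (in [only_crisp] of that context, for a crisp entry). *)
Reserved Notation "G ⊢ t ≡ s ∈ A"
  (at level 70, t at level 65, s at level 65, A at level 65, no associativity).
Reserved Notation "G ⊢ t ∈ A"
  (at level 70, t at level 65, A at level 65, no associativity).

Inductive eqtm : ctx -> tm -> tm -> tm -> Prop :=

| e_sym G t s A : G ⊢ t ≡ s ∈ A -> G ⊢ s ≡ t ∈ A
| e_trans G t s u A : G ⊢ t ≡ s ∈ A -> G ⊢ s ≡ u ∈ A -> G ⊢ t ≡ u ∈ A
| e_conv G t s A B i : G ⊢ t ≡ s ∈ A -> G ⊢ A ≡ B ∈ Univ i -> G ⊢ t ≡ s ∈ B

| e_var G n m A :
    nth_error G n = Some (m, A) -> m <> hidden ->
    G ⊢ Var n ∈ wk (S n) A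

| e_univ G i : G ⊢ Univ i ∈ Univ (S i)
| e_cumul G A A' i : G ⊢ A ≡ A' ∈ Univ i -> G ⊢ A ≡ A' ∈ Univ (S i)

| e_pi G A A' B B' i :
    G ⊢ A ≡ A' ∈ Univ i -> G ,, A ⊢ B ≡ B' ∈ Univ i ->
    G ⊢ Pi A B ≡ Pi A' B' ∈ Univ i
| e_lam G A A' B b b' i :
    G ⊢ A ≡ A' ∈ Univ i -> G ,, A ⊢ b ≡ b' ∈ B ->
    G ⊢ Lam A b ≡ Lam A' b' ∈ Pi A B
| e_app G A B f f' a a' :
    G ⊢ f ≡ f' ∈ Pi A B -> G ⊢ a ≡ a' ∈ A ->
    G ⊢ App f a ≡ App f' a' ∈ B[[a ⋅ vars 0]]
| e_pi_beta G A B b a i :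
    G ⊢ A ∈ Univ i -> G ,, A ⊢ b ∈ B -> G ⊢ a ∈ A ->
    G ⊢ App (Lam A b) a ≡ b[[a ⋅ vars 0]] ∈ B[[a ⋅ vars 0]]
| e_pi_eta G A B f :
    G ⊢ f ∈ Pi A B ->
    G ⊢ f ≡ Lam A (App (wk 1 f) (Var 0)) ∈ Pi A B

| e_sig G A A' B B' i :
    G ⊢ A ≡ A' ∈ Univ i -> G ,, A ⊢ B ≡ B' ∈ Univ i ->
    G ⊢ Sig A B ≡ Sig A' B' ∈ Univ i
| e_pair G A B a a' b b' i :
    G ,, A ⊢ B ∈ Univ i ->
    G ⊢ a ≡ a' ∈ A -> G ⊢ b ≡ b' ∈ B[[a ⋅ vars 0]] ->
    G ⊢ Pair a b ≡ Pair a' b' ∈ Sig A B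
| e_split G A B C C' b b' p p' i :
    G ,, Sig A B ⊢ C ≡ C' ∈ Univ i ->
    G ,, A ,, B ⊢ b ≡ b' ∈ C[[Pair (Var 1) (Var 0) ⋅ vars 2]] ->
    G ⊢ p ≡ p' ∈ Sig A B ->
    G ⊢ Split C b p ≡ Split C' b' p' ∈ C[[p ⋅ vars 0]]
| e_sig_beta G A B C b x y i :
    G ,, Sig A B ⊢ C ∈ Univ i ->
    G ,, A ,, B ⊢ b ∈ C[[Pair (Var 1) (Var 0) ⋅ vars 2]] ->
    G ⊢ x ∈ A -> G ⊢ y ∈ B[[x ⋅ vars 0]] ->
    G ⊢ Split C b (Pair x y) ≡ b[[y ⋅ x ⋅ vars 0]] ∈ C[[Pair x y ⋅ vars 0]]

| e_empty G i : G ⊢ Empty ∈ Univ i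
| e_empty_ind G C C' t t' i :
    G ,, Empty ⊢ C ≡ C' ∈ Univ i -> G ⊢ t ≡ t' ∈ Empty ->
    G ⊢ EmptyInd C t ≡ EmptyInd C' t' ∈ C[[t ⋅ vars 0]]

| e_unit G i : G ⊢ Unit ∈ Univ i
| e_star G : G ⊢ Star ∈ Unit
| e_unit_ind G C C' b b' t t' i :
    G ,, Unit ⊢ C ≡ C' ∈ Univ i -> G ⊢ b ≡ b' ∈ C[[Star ⋅ vars 0]] ->
    G ⊢ t ≡ t' ∈ Unit ->
    G ⊢ UnitInd C b t ≡ UnitInd C' b' t' ∈ C[[t ⋅ vars 0]]
| e_unit_beta G C b i :
    G ,, Unit ⊢ C ∈ Univ i -> G ⊢ b ∈ C[[Star ⋅ vars 0]] ->
    G ⊢ UnitInd C b Star ≡ b ∈ C[[Star ⋅ vars 0]]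

| e_sum G A A' B B' i :
    G ⊢ A ≡ A' ∈ Univ i -> G ⊢ B ≡ B' ∈ Univ i ->
    G ⊢ Sum A B ≡ Sum A' B' ∈ Univ i
| e_inl G A B a a' i :
    G ⊢ A ∈ Univ i -> G ⊢ B ∈ Univ i -> G ⊢ a ≡ a' ∈ A ->
    G ⊢ Inl a ≡ Inl a' ∈ Sum A B
| e_inr G A B b b' i :
    G ⊢ A ∈ Univ i -> G ⊢ B ∈ Univ i -> G ⊢ b ≡ b' ∈ B ->
    G ⊢ Inr b ≡ Inr b' ∈ Sum A B
| e_case G A B C C' l l' r r' t t' i :
    G ,, Sum A B ⊢ C ≡ C' ∈ Univ i ->
    G ,, A ⊢ l ≡ l' ∈ C[[Inl (Var 0) ⋅ vars 1]] ->
    G ,, B ⊢ r ≡ r' ∈ C[[Inr (Var 0) ⋅ vars 1]] ->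
    G ⊢ t ≡ t' ∈ Sum A B ->
    G ⊢ Case C l r t ≡ Case C' l' r' t' ∈ C[[t ⋅ vars 0]]
| e_inl_beta G A B C l r a i :
    G ,, Sum A B ⊢ C ∈ Univ i ->
    G ,, A ⊢ l ∈ C[[Inl (Var 0) ⋅ vars 1]] ->
    G ,, B ⊢ r ∈ C[[Inr (Var 0) ⋅ vars 1]] ->
    G ⊢ a ∈ A ->
    G ⊢ Case C l r (Inl a) ≡ l[[a ⋅ vars 0]] ∈ C[[Inl a ⋅ vars 0]]
| e_inr_beta G A B C l r b i :
    G ,, Sum A B ⊢ C ∈ Univ i ->
    G ,, A ⊢ l ∈ C[[Inl (Var 0) ⋅ vars 1]] ->
    G ,, B ⊢ r ∈ C[[Inr (Var 0) ⋅ vars 1]] ->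
    G ⊢ b ∈ B ->
    G ⊢ Case C l r (Inr b) ≡ r[[b ⋅ vars 0]] ∈ C[[Inr b ⋅ vars 0]]

| e_nat G i : G ⊢ Nat ∈ Univ i
| e_zero G : G ⊢ Zero ∈ Nat
| e_suc G n n' : G ⊢ n ≡ n' ∈ Nat -> G ⊢ Suc n ≡ Suc n' ∈ Nat
| e_nat_ind G C C' z z' s s' n n' i :
    G ,, Nat ⊢ C ≡ C' ∈ Univ i ->
    G ⊢ z ≡ z' ∈ C[[Zero ⋅ vars 0]] ->
    G ,, Nat ,, C ⊢ s ≡ s' ∈ C[[Suc (Var 1) ⋅ vars 2]] ->
    G ⊢ n ≡ n' ∈ Nat ->
    G ⊢ NatInd C z s n ≡ NatInd C' z' s' n' ∈ C[[n ⋅ vars 0]]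
| e_zero_beta G C z s i :
    G ,, Nat ⊢ C ∈ Univ i ->
    G ⊢ z ∈ C[[Zero ⋅ vars 0]] ->
    G ,, Nat ,, C ⊢ s ∈ C[[Suc (Var 1) ⋅ vars 2]] ->
    G ⊢ NatInd C z s Zero ≡ z ∈ C[[Zero ⋅ vars 0]]
| e_suc_beta G C z s n i :
    G ,, Nat ⊢ C ∈ Univ i ->
    G ⊢ z ∈ C[[Zero ⋅ vars 0]] ->
    G ,, Nat ,, C ⊢ s ∈ C[[Suc (Var 1) ⋅ vars 2]] ->
    G ⊢ n ∈ Nat ->
    G ⊢ NatInd C z s (Suc n) ≡ s[[NatInd C z s n ⋅ n ⋅ vars 0]]
      ∈ C[[Suc n ⋅ vars 0]]

| e_id G A A' a a' b b' i :
    G ⊢ A ≡ A' ∈ Univ i -> G ⊢ a ≡ a' ∈ A -> G ⊢ b ≡ b' ∈ A ->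
    G ⊢ Id A a b ≡ Id A' a' b' ∈ Univ i
| e_refl G A a a' : G ⊢ a ≡ a' ∈ A -> G ⊢ Refl a ≡ Refl a' ∈ Id A a a
| e_J G A C C' d d' a a' b b' p p' i :
    G ,, A ,, wk 1 A ,, Id (wk 2 A) (Var 1) (Var 0) ⊢ C ≡ C' ∈ Univ i ->
    G ,, A ⊢ d ≡ d' ∈ C[[Refl (Var 0) ⋅ Var 0 ⋅ Var 0 ⋅ vars 1]] ->
    G ⊢ a ≡ a' ∈ A -> G ⊢ b ≡ b' ∈ A -> G ⊢ p ≡ p' ∈ Id A a b ->
    G ⊢ J C d a b p ≡ J C' d' a' b' p' ∈ C[[p ⋅ b ⋅ a ⋅ vars 0]]
| e_J_beta G A C d a i :
    G ,, A ,, wk 1 A ,, Id (wk 2 A) (Var 1) (Var 0) ⊢ C ∈ Univ i ->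
    G ,, A ⊢ d ∈ C[[Refl (Var 0) ⋅ Var 0 ⋅ Var 0 ⋅ vars 1]] ->
    G ⊢ a ∈ A ->
    G ⊢ J C d a a (Refl a) ≡ d[[a ⋅ vars 0]] ∈ C[[Refl a ⋅ a ⋅ a ⋅ vars 0]]

| e_tr G A A' i : G ⊢ A ≡ A' ∈ Univ i -> G ⊢ Tr A ≡ Tr A' ∈ Univ i
| e_trI G A a a' : G ⊢ a ≡ a' ∈ A -> G ⊢ TrI a ≡ TrI a' ∈ Tr A
| e_trP G A a a' b b' :
    G ⊢ a ≡ a' ∈ Tr A -> G ⊢ b ≡ b' ∈ Tr A ->
    G ⊢ TrP a b ≡ TrP a' b' ∈ Id (Tr A) a b
| e_trRec G A B B' h h' f f' t t' i :
    G ⊢ B ≡ B' ∈ Univ i -> G ⊢ h ≡ h' ∈ isProp B ->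
    G ⊢ f ≡ f' ∈ arrow A B -> G ⊢ t ≡ t' ∈ Tr A ->
    G ⊢ TrRec B h f t ≡ TrRec B' h' f' t' ∈ B
| e_tr_beta G A B h f a i :
    G ⊢ B ∈ Univ i -> G ⊢ h ∈ isProp B -> G ⊢ f ∈ arrow A B -> G ⊢ a ∈ A ->
    G ⊢ TrRec B h f (TrI a) ≡ App f a ∈ B

| e_flat G A A' i :
    only_crisp G ⊢ A ≡ A' ∈ Univ i -> G ⊢ Flat A ≡ Flat A' ∈ Univ i
| e_flatI G A a a' :
    only_crisp G ⊢ a ≡ a' ∈ A -> G ⊢ FlatI a ≡ FlatI a' ∈ Flat A
| e_flatE G A C C' N N' M M' i :
    G ,, Flat A ⊢ C ≡ C' ∈ Univ i ->
    G ,,♭ A ⊢ N ≡ N' ∈ C[[FlatI (Var 0) ⋅ vars 1]] ->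
    G ⊢ M ≡ M' ∈ Flat A ->
    G ⊢ FlatE C N M ≡ FlatE C' N' M' ∈ C[[M ⋅ vars 0]]
| e_flat_beta G A C N a i :
    G ,, Flat A ⊢ C ∈ Univ i ->
    G ,,♭ A ⊢ N ∈ C[[FlatI (Var 0) ⋅ vars 1]] ->
    only_crisp G ⊢ a ∈ A ->
    G ⊢ FlatE C N (FlatI a) ≡ N[[a ⋅ vars 0]] ∈ C[[FlatI a ⋅ vars 0]]

| e_sharp G A A' i :
    all_crisp G ⊢ A ≡ A' ∈ Univ i -> G ⊢ Sharp A ≡ Sharp A' ∈ Univ i
| e_sharpI G A a a' :
    all_crisp G ⊢ a ≡ a' ∈ A -> G ⊢ SharpI a ≡ SharpI a' ∈ Sharp A
| e_sharpE G A a a' :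
    only_crisp G ⊢ a ≡ a' ∈ Sharp A -> G ⊢ SharpE a ≡ SharpE a' ∈ A
| e_sharp_beta G A a :
    only_crisp G ⊢ a ∈ A -> G ⊢ SharpE (SharpI a) ≡ a ∈ A
| e_sharp_eta G A a :
    G ⊢ a ∈ Sharp A -> G ⊢ a ≡ SharpI (SharpE a) ∈ Sharp A

| e_ua G i :
    G ⊢ UA i ∈
      Pi (Univ i) (Pi (Univ i)
        (isEquiv (Id (Univ i) (Var 1) (Var 0)) (Equiv (Var 1) (Var 0))
           (idtoEquiv i (Var 1) (Var 0))))
| e_lem G P P' h h' i :
    only_crisp G ⊢ P ≡ P' ∈ Univ i -> only_crisp G ⊢ h ≡ h' ∈ isProp P ->
    G ⊢ LEM P h ≡ LEM P' h' ∈ or P (neg P)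
| e_rflat G X X' i :
    only_crisp G ⊢ X ≡ X' ∈ Univ i ->
    G ⊢ RFlat X ≡ RFlat X' ∈ iff (isCrisplyDiscrete X) (isDiscrete X)

where "G ⊢ t ≡ s ∈ A" := (eqtm G t s A)
  and "G ⊢ t ∈ A" := (eqtm G t t A).

(* Main.v *)
Require Import Defs.
From Stdlib Require Import List Lia.
Import ListNotations.

(* Write [B] for [BAut X x].  For crisp [c, d :: B], a path [p : c = d] projects to a
   path between crisp points of [X], which by hypothesis is equal to a crisp one, and
   that crisp path lifts back to a crisp path [c = d] equal to [p], because [B -> X]
   is an embedding.  Crisp path induction (path induction into a [Sharp] type) then
   shows that every element [(v, p)] of the fiber of the counit over [eps w] equals
   [(w, refl)], so all fibers of the counit are propositions.  They are inhabited: to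
   inhabit a proposition over [(y, t)] we may assume [t] to come from a path [x = y],
   and [x^flat] is a point over [(x, refl)].  Hence the counit of [B] is an
   equivalence; axiom R-flat gives discreteness. *)

(** * A type checker *)

Lemma conv_type G t s A A' :
  G ⊢ t ≡ s ∈ A -> (A = A' \/ exists i, G ⊢ A ≡ A' ∈ Univ i) -> G ⊢ t ≡ s ∈ A'.
Proof. intros H [ <- | [ i Hi ] ]; [assumption | eapply e_conv; eassumption]. Qed.

Lemma eq_type G t s A A' : G ⊢ t ≡ s ∈ A -> A = A' -> G ⊢ t ≡ s ∈ A'.
Proof. intros ? <-; assumption. Qed.

Lemma cumul_le G A A' i j : G ⊢ A ≡ A' ∈ Univ i -> i <= j -> G ⊢ A ≡ A' ∈ Univ j.
Proof. intros H; induction 1; [assumption | apply e_cumul; assumption]. Qed.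

(* Elimination and computation rules whose first premise determines the types of the
   bound variables of the others. *)

Lemma split_rule i G A B C C' b b' p p' :
  G ⊢ p ≡ p' ∈ Sig A B ->
  G ,, Sig A B ⊢ C ≡ C' ∈ Univ i ->
  G ,, A ,, B ⊢ b ≡ b' ∈ C[[Pair (Var 1) (Var 0) ⋅ vars 2]] ->
  G ⊢ Split C b p ≡ Split C' b' p' ∈ C[[p ⋅ vars 0]].
Proof. intros; eapply e_split; eassumption. Qed.

Lemma sig_beta_rule i G A B C b x y :
  G ⊢ Pair x y ∈ Sig A B ->
  G ⊢ x ∈ A -> G ⊢ y ∈ B[[x ⋅ vars 0]] ->
  G ,, Sig A B ⊢ C ∈ Univ i ->
  G ,, A ,, B ⊢ b ∈ C[[Pair (Var 1) (Var 0) ⋅ vars 2]] ->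
  G ⊢ Split C b (Pair x y) ≡ b[[y ⋅ x ⋅ vars 0]] ∈ C[[Pair x y ⋅ vars 0]].
Proof. intros; eapply e_sig_beta; eassumption. Qed.

Lemma J_rule i G A C C' d d' a a' b b' p p' :
  G ⊢ a ≡ a' ∈ A -> G ⊢ b ≡ b' ∈ A -> G ⊢ p ≡ p' ∈ Id A a b ->
  G ,, A ,, wk 1 A ,, Id (wk 2 A) (Var 1) (Var 0) ⊢ C ≡ C' ∈ Univ i ->
  G ,, A ⊢ d ≡ d' ∈ C[[Refl (Var 0) ⋅ Var 0 ⋅ Var 0 ⋅ vars 1]] ->
  G ⊢ J C d a b p ≡ J C' d' a' b' p' ∈ C[[p ⋅ b ⋅ a ⋅ vars 0]].
Proof. intros; eapply e_J; eassumption. Qed.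

(** The path comes first, since its type fixes [A] when an endpoint is an unannotated pair. *)
Lemma J_rule_path i G A C C' d d' a a' b b' p p' :
  G ⊢ p ≡ p' ∈ Id A a b -> G ⊢ a ≡ a' ∈ A -> G ⊢ b ≡ b' ∈ A ->
  G ,, A ,, wk 1 A ,, Id (wk 2 A) (Var 1) (Var 0) ⊢ C ≡ C' ∈ Univ i ->
  G ,, A ⊢ d ≡ d' ∈ C[[Refl (Var 0) ⋅ Var 0 ⋅ Var 0 ⋅ vars 1]] ->
  G ⊢ J C d a b p ≡ J C' d' a' b' p' ∈ C[[p ⋅ b ⋅ a ⋅ vars 0]].
Proof. intros; eapply e_J; eassumption. Qed.

Lemma J_beta_rule i G A C d a :
  G ⊢ a ∈ A ->
  G ,, A ,, wk 1 A ,, Id (wk 2 A) (Var 1) (Var 0) ⊢ C ∈ Univ i ->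
  G ,, A ⊢ d ∈ C[[Refl (Var 0) ⋅ Var 0 ⋅ Var 0 ⋅ vars 1]] ->
  G ⊢ J C d a a (Refl a) ≡ d[[a ⋅ vars 0]] ∈ C[[Refl a ⋅ a ⋅ a ⋅ vars 0]].
Proof. intros; eapply e_J_beta; eassumption. Qed.

Lemma flatE_rule i G A C C' N N' M M' :
  G ⊢ M ≡ M' ∈ Flat A ->
  G ,, Flat A ⊢ C ≡ C' ∈ Univ i ->
  G ,,♭ A ⊢ N ≡ N' ∈ C[[FlatI (Var 0) ⋅ vars 1]] ->
  G ⊢ FlatE C N M ≡ FlatE C' N' M' ∈ C[[M ⋅ vars 0]].
Proof. intros; eapply e_flatE; eassumption. Qed.

Lemma flat_beta_rule i G A C N a :
  only_crisp G ⊢ a ∈ A ->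
  G ,, Flat A ⊢ C ∈ Univ i ->
  G ,,♭ A ⊢ N ∈ C[[FlatI (Var 0) ⋅ vars 1]] ->
  G ⊢ FlatE C N (FlatI a) ≡ N[[a ⋅ vars 0]] ∈ C[[FlatI a ⋅ vars 0]].
Proof. intros; eapply e_flat_beta; eassumption. Qed.

Lemma trRec_rule i G A B B' h h' f f' t t' :
  G ⊢ t ≡ t' ∈ Tr A ->
  G ⊢ B ≡ B' ∈ Univ i -> G ⊢ h ≡ h' ∈ isProp B ->
  G ⊢ f ≡ f' ∈ arrow A B ->
  G ⊢ TrRec B h f t ≡ TrRec B' h' f' t' ∈ B.
Proof. intros; eapply e_trRec; eassumption. Qed.

(* Infers the type of an unannotated pair that lies in a fiber of [f]. *)
Lemma fiber_pair_rule i G A A' f x b y :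
  G ⊢ x ∈ A -> G ⊢ y ∈ Id A' (App f x) b ->
  G ,, A ⊢ Id (wk 1 A') (App (wk 1 f) (Var 0)) (wk 1 b) ∈ Univ i ->
  Id A' (App f x) b = (Id (wk 1 A') (App (wk 1 f) (Var 0)) (wk 1 b)) [[x ⋅ vars 0]] ->
  G ⊢ Pair x y ∈ Sig A (Id (wk 1 A') (App (wk 1 f) (Var 0)) (wk 1 b)).
Proof. intros ? Hy ? E; rewrite E in Hy; eapply e_pair; eassumption. Qed.

(* Throughout, [k] is the de Bruijn index of the base point [x] in the context at
   hand, so that [X] is [Var (1 + k)]. *)
Definition baut (k : nat) : tm := BAut (Var (1 + k)) (Var k).

Ltac unfold_types := cbv beta.

Ltac normalize :=
  unfold_types;
  cbv [isLocallyCrisplyDiscrete isCrisplyDiscrete BAut constPath isDiscrete counit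
       Real isCut locatedCut disjointCut roundedCut inhabitedCut holds Omega
       ltRat den negPart posPart Rat coprime ltNat mul add
       isEquiv isProp ex or iff neg prod arrow baut
       subst ren up up_ren scons vars shift wk only_crisp all_crisp map fst snd Nat.add].

Ltac up_to_eq tac := eapply eq_type; [ tac | normalize; reflexivity ].

Ltac is_redex t :=
  lazymatch t with
  | App (Lam _ _) _ => idtac
  | App ?f _ => is_redex f
  | Split _ _ (Pair _ _) => idtac
  | Split _ _ ?p => is_redex p
  | FlatE _ _ (FlatI _) => idtac
  | FlatE _ _ ?p => is_redex p
  | J _ _ _ _ (Refl _) => idtac
  | J _ _ _ _ ?p => is_redex p
  end.

(* Every context below ends in [x :: X] and [X :: Univ i]. *)
Ltac base_point_index G :=
  lazymatch G with
  | [_; _] => constr:(0)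
  | _ :: ?G' => let k := base_point_index G' in constr:(S k)
  end.

Ltac known_type := fail.

(* [check L] derives a typed equation (in particular, a typing) between normalized
   terms by congruence and, where its two sides differ, by head reduction; the type may
   be an evar, which is then inferred.  [L] is the level of all auxiliary type
   formations.  The type of an unannotated pair cannot be inferred in general: it is
   taken to be [baut] of the base point or else the fiber of a function. *)
Ltac check L :=
  lazymatch goal with |- eqtm _ ?t ?s _ =>
    tryif constr_eq t s then congr L else
    tryif is_redex t then (eapply e_trans; [ reduce_in L | normalize; check L ]) else
    tryif is_redex s then (apply e_sym; check L) else congr L
  end
with reduce_in L :=
  lazymatch goal with |- eqtm _ _ _ ?T =>
    tryif is_evar T then reduce L else
    lazymatch T with
    | Univ _ => eapply cumul_le; [ reduce L | lia ]
    | _ => eapply conv_type; [ reduce L | convert L ]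
    end
  end
with reduce L :=
  lazymatch goal with |- eqtm _ ?t _ _ =>
  lazymatch t with
  | App (Lam _ _) _ =>
      up_to_eq ltac:(eapply e_pi_beta with (i := L); [check L | check L | check L])
  | Split _ _ (Pair _ _) =>
      up_to_eq ltac:(eapply (sig_beta_rule L);
        [check L | check L | normalize; check L | check L | normalize; check L])
  | FlatE _ _ (FlatI _) =>
      up_to_eq ltac:(eapply (flat_beta_rule L);
        [normalize; check L | check L | normalize; check L])
  | J _ _ _ _ (Refl _) =>
      up_to_eq ltac:(eapply (J_beta_rule L);
        [check L | normalize; check L | normalize; check L])
  | App _ _ => up_to_eq ltac:(eapply e_app; [reduce L | check L])
  | Split _ _ _ =>
      up_to_eq ltac:(eapply (split_rule L); [reduce L | check L | normalize; check L])
  | FlatE _ _ _ =>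
      up_to_eq ltac:(eapply (flatE_rule L); [reduce L | check L | normalize; check L])
  | J _ _ _ _ _ =>
      up_to_eq ltac:(eapply (J_rule L);
        [check L | check L | reduce_in L | normalize; check L | normalize; check L])
  end end
with convert L :=
  normalize; first [ left; reflexivity | right; exists L; check L ]
with infer L :=
  lazymatch goal with |- eqtm ?G ?t _ _ =>
  lazymatch t with
  | Var _ => up_to_eq ltac:(eapply e_var; [reflexivity | discriminate])
  | Univ _ => eapply e_univ
  | App _ _ => up_to_eq ltac:(eapply e_app; [check L | check L])
  | Lam _ _ => eapply e_lam with (i := L); [check L | check L]
  | Split _ _ _ =>
      up_to_eq ltac:(eapply (split_rule L); [check L | check L | normalize; check L])
  | FlatE _ _ _ =>
      up_to_eq ltac:(eapply (flatE_rule L); [check L | check L | normalize; check L])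
  | J _ _ (Pair _ _) _ _ =>
      up_to_eq ltac:(eapply (J_rule_path L);
        [check L | check L | check L | normalize; check L | normalize; check L])
  | J _ _ _ _ _ =>
      up_to_eq ltac:(eapply (J_rule L);
        [check L | check L | check L | normalize; check L | normalize; check L])
  | NatInd _ _ _ _ =>
      up_to_eq ltac:(eapply e_nat_ind with (i := L);
        [check L | normalize; check L | normalize; check L | check L])
  | Zero => eapply e_zero
  | Suc _ => eapply e_suc; check L
  | Refl _ => eapply e_refl; check L
  | TrI _ => eapply e_trI; check L
  | TrP _ _ => eapply e_trP; [check L | check L]
  | TrRec _ _ _ _ =>
      eapply (trRec_rule L); [check L | check L | normalize; check L | normalize; check L]
  | FlatI _ => eapply e_flatI; normalize; check L
  | SharpI _ => eapply e_sharpI; normalize; check L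
  | SharpE _ => eapply e_sharpE; normalize; check L
  | RFlat _ => up_to_eq ltac:(eapply e_rflat with (i := L); normalize; check L)
  | Pair _ _ => first
      [ let k := base_point_index G in
        eapply (eq_type _ _ _ (baut k)); [ normalize; check L | normalize; reflexivity ]
      | up_to_eq ltac:(eapply (fiber_pair_rule L);
          [check L | check L | normalize; check L | reflexivity]) ]
  end end
with congr L :=
  lazymatch goal with |- eqtm _ ?t _ ?T =>
  tryif is_evar T then infer L else
  lazymatch T with
  | Univ _ =>
    tryif known_type then idtac else
    lazymatch t with
    | Pi _ _ => eapply e_pi; [check L | check L]
    | Sig _ _ => eapply e_sig; [check L | check L]
    | Sum _ _ => eapply e_sum; [check L | check L]
    | Id _ _ _ => eapply e_id; [check L | check L | check L]
    | Tr _ => eapply e_tr; check L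
    | Flat _ => eapply e_flat; normalize; check L
    | Sharp _ => eapply e_sharp; normalize; check L
    | Empty => eapply e_empty
    | Nat => eapply e_nat
    | _ => eapply cumul_le; [infer L | lia]
    end
  | Pi _ _ =>
    lazymatch t with
    | Lam _ _ => eapply e_lam with (i := L); [check L | check L]
    | _ => eapply conv_type; [infer L | convert L]
    end
  | _ =>
    tryif has_evar T then (eapply conv_type; [infer L | convert L]) else
    lazymatch t with
    | Pair _ _ => eapply e_pair with (i := L); [check L | check L | normalize; check L]
    | FlatI _ => eapply e_flatI; normalize; check L
    | SharpI _ => eapply e_sharpI; normalize; check L
    | TrI _ => eapply e_trI; check L
    | Refl ?a =>
        lazymatch T with Id ?A _ _ =>
          eapply (conv_type _ _ _ (Id A a a)); [eapply e_refl; check L | convert L] end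
    | _ => eapply conv_type; [infer L | convert L]
    end
  end end.

Definition Real_nf : tm := Eval cbv in Real.

(** Cuts are maps into [Omega], which sums over [Univ 0]; hence the successor level. *)
Lemma Real_type G i : G ⊢ Real_nf ∈ Univ (S i).
Proof. cbv [Real_nf]; check (S i). Qed.

(* Saves checking [Real] at each of its occurrences. *)
Ltac known_type ::=
  lazymatch goal with |- eqtm _ ?t ?s _ =>
    let r := eval cbv delta [Real_nf] in Real_nf in
    constr_eq t r; constr_eq s r; apply Real_type
  end.

Ltac inhabit i t := exists t; normalize; check (S i).

(** * Types and terms of the object theory *)

Definition app (f : tm) (l : list tm) : tm := fold_left App l f.
Definition arrows (l : list tm) (A : tm) : tm := fold_right arrow A l.

Definition lcd (i k : nat) : tm := isLocallyCrisplyDiscrete i (Var (1 + k)).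
Definition mere (k : nat) (y : tm) : tm := Tr (Id (Var (1 + k)) (Var k) y).
Definition pt (k : nat) (c : tm) : tm := Split (Var (2 + k)) (Var 1) c.
Definition eps (k : nat) (v : tm) : tm := App (counit (baut k)) v.
Definition fiber (k : nat) (b : tm) : tm :=
  Sig (Flat (baut k)) (Id (baut (1 + k)) (eps (1 + k) (Var 0)) (wk 1 b)).
Definition fiber_fst (k : nat) (u : tm) : tm := Split (Flat (baut (1 + k))) (Var 1) u.
Definition fiber_snd (k : nat) (b u : tm) : tm :=
  Split (Id (baut (1 + k)) (eps (1 + k) (fiber_fst (1 + k) (Var 0))) (wk 1 b)) (Var 0) u.

(* [P] depends on one more variable, and [u : P a], [p : a = b]. *)
Definition transport (P a b p u : tm) : tm :=
  App (J (arrow P[[Var 2 ⋅ vars 3]] P[[Var 1 ⋅ vars 3]]) (Lam P (Var 0)) a b p) u.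

Definition PairPath (k : nat) (y z : tm) : tm :=
  Pi (mere k y) (Pi (mere (1 + k) (wk 1 z))
    (Id (baut (2 + k)) (Pair (wk 2 y) (Var 1)) (Pair (wk 2 z) (Var 0)))).
Definition PairPaths (k : nat) : tm :=
  Pi (Var (1 + k)) (Pi (Var (2 + k)) (Pi (Id (Var (3 + k)) (Var 1) (Var 0))
    (PairPath (3 + k) (Var 2) (Var 1)))).
Definition LiftPaths (k : nat) : tm :=
  Pi (baut k) (Pi (baut (1 + k))
    (arrow (Id (Var (3 + k)) (pt (2 + k) (Var 1)) (pt (2 + k) (Var 0)))
           (Id (baut (2 + k)) (Var 1) (Var 0)))).

(* Here [j] is the index of a variable [m : LiftPaths] bound right after [x], so that
   [k = 1 + j].  Composing [m c d q] with the inverse of the loop [m c c refl] makes the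
   lift of [refl] equal to [refl] whatever [m] is. *)
Definition lift (j : nat) (c d q : tm) : tm :=
  transport (Id (baut (2 + j)) (Var 0) (wk 1 d)) c c
    (app (Var j) [c; c; Refl (pt (1 + j) c)]) (app (Var j) [c; d; q]).
Definition pt_path (j : nat) (c d p : tm) : tm :=
  J (Id (Var (5 + j)) (pt (4 + j) (Var 2)) (pt (4 + j) (Var 1)))
    (Refl (pt (2 + j) (Var 0))) c d p.
Definition LiftPtPath (j : nat) : tm :=
  Pi (baut (1 + j)) (Pi (baut (2 + j)) (Pi (Id (baut (3 + j)) (Var 1) (Var 0))
    (Id (Id (baut (4 + j)) (Var 2) (Var 1))
      (lift (3 + j) (Var 2) (Var 1) (pt_path (3 + j) (Var 2) (Var 1) (Var 0)))
      (Var 0)))).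

Definition center_path (k : nat) (v w p : tm) : tm :=
  Id (fiber k (eps k w)) (Pair w (Refl (eps k w))) (Pair v p).
Definition CenterPath (k : nat) (v w : tm) : tm :=
  Pi (Id (baut k) (eps k v) (eps k w)) (center_path (1 + k) (wk 1 v) (wk 1 w) (Var 0)).
Definition CenterPathFrom (k : nat) (v : tm) : tm :=
  Pi (Flat (baut k)) (CenterPath (1 + k) (wk 1 v) (Var 0)).
Definition CenterPaths (k : nat) : tm :=
  Pi (Flat (baut k)) (CenterPathFrom (1 + k) (Var 0)).

(* Crisp path induction: under [Sharp] the variables bound by the motive become crisp. *)
Definition crisp_center_path (j : nat) (c d r : tm) : tm :=
  SharpE (J
    (Sharp (Id (fiber (4 + j) (Var 1)) (Pair (FlatI (Var 1)) (Refl (Var 1)))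
              (Pair (FlatI (Var 2)) (Var 0))))
    (SharpI (Refl (Pair (FlatI (Var 0)) (Refl (Var 0)))))
    c d r).

Definition PropFibers (k : nat) : tm :=
  Pi (baut k) (isProp (fiber (1 + k) (Var 0))).
Definition PropFibersOverCounit (k : nat) : tm :=
  Pi (Flat (baut k)) (isProp (fiber (1 + k) (eps (1 + k) (Var 0)))).
Definition FiberSection (k : nat) : tm := Pi (baut k) (fiber (1 + k) (Var 0)).

Definition bothDiscrete (k : nat) : tm :=
  prod (isCrisplyDiscrete (baut k)) (isDiscrete (baut k)).

Definition pointed_ctx (i : nat) : ctx := [] ,,♭ Univ i ,,♭ Var 0.
Definition lift_ctx (i : nat) : ctx := pointed_ctx i ,,♭ LiftPaths 0.

Ltac unfold_types ::=
  cbv [lift_ctx pointed_ctx bothDiscrete FiberSection PropFibersOverCounit PropFibers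
       CenterPaths CenterPathFrom CenterPath center_path crisp_center_path
       LiftPtPath pt_path lift LiftPaths PairPaths PairPath transport fiber_snd
       fiber_fst fiber eps pt mere lcd arrows app fold_left fold_right].

(** * Lifting paths along [BAut X x -> X] *)

(** Path induction on [y = z] leaves two witnesses of [mere y], which [TrP] identifies. [PairPath]
    quantifies over the witnesses after the path, so that this induction applies. *)
Lemma lift_paths (i : nat) : exists t, pointed_ctx i ⊢ t ∈ LiftPaths 0.
Proof.
  inhabit i
   (app
     (Lam (PairPaths 0) (Lam (baut 1)
       (Split
         (Pi (baut 3) (arrow (Id (Var 5) (pt 4 (Var 1)) (pt 4 (Var 0)))
                             (Id (baut 4) (Var 1) (Var 0))))
         (Lam (baut 4)
           (Split
             (arrow (Id (Var 7) (pt 6 (Pair (Var 3) (Var 2))) (pt 6 (Var 0)))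
                    (Id (baut 6) (Pair (Var 3) (Var 2)) (Var 0)))
             (Lam (Id (Var 8) (pt 7 (Pair (Var 4) (Var 3))) (pt 7 (Pair (Var 1) (Var 0))))
               (app (Var 7) [Var 5; Var 2; Var 0; Var 4; Var 1]))
             (Var 0)))
         (Var 0))))
     [Lam (Var 1) (Lam (Var 2) (Lam (Id (Var 3) (Var 1) (Var 0))
       (J (PairPath 6 (Var 2) (Var 1))
         (Lam (mere 4 (Var 0)) (Lam (mere 5 (Var 1))
           (J (Id (baut 9) (Pair (Var 5) (Var 2)) (Pair (Var 5) (Var 1)))
             (Refl (Pair (Var 3) (Var 0)))
             (Var 1) (Var 0) (TrP (Var 1) (Var 0)))))
         (Var 2) (Var 1) (Var 0))))]).
Qed.

(** For [p = refl] the lift is the loop [m c c refl] transported along itself. A second path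
    induction shows that any path transported along itself in its left endpoint is [refl]. *)
Lemma lift_pt_path (i : nat) : exists t, lift_ctx i ⊢ t ∈ LiftPtPath 0.
Proof.
  inhabit i
   (Lam (baut 1) (Lam (baut 2) (Lam (Id (baut 3) (Var 1) (Var 0))
     (J (Id (Id (baut 7) (Var 2) (Var 1))
           (lift 6 (Var 2) (Var 1) (pt_path 6 (Var 2) (Var 1) (Var 0))) (Var 0))
       (J (Id (Id (baut 8) (Var 1) (Var 1))
             (transport (Id (baut 9) (Var 0) (Var 2)) (Var 2) (Var 1) (Var 0) (Var 0))
             (Refl (Var 1)))
         (Refl (Refl (Var 0)))
         (Var 0) (Var 0) (app (Var 4) [Var 0; Var 0; Refl (pt 5 (Var 0))]))
       (Var 2) (Var 1) (Var 0))))).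
Qed.

(** * The fibers of the counit *)

(* The body binds, from the outside in, [v], [c] with [c^flat] for [v], [w], [d] with
   [d^flat] for [w], [p : eps v = eps w], the equivalence [flat (pt c = pt d) -> (pt c =
   pt d)] with its two halves, a right inverse [g] with its homotopy, [r] with [r^flat]
   for [g (pt_path p)], and [e : r = pt_path p]; it transports [crisp_center_path] for
   [lift r] along [e] and then along [lift (pt_path p) = p]. *)
Lemma center_paths (i : nat) : exists t,
  lift_ctx i ⊢ t ∈ arrows [LiftPtPath 0; lcd i 1] (CenterPaths 1).
Proof.
  inhabit i
   (Lam (LiftPtPath 0) (Lam (lcd i 2)
     (Lam (Flat (baut 3)) (FlatE (CenterPathFrom 5 (Var 0))
       (Lam (Flat (baut 5)) (FlatE (CenterPath 7 (FlatI (Var 2)) (Var 0))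
         (Lam (Id (baut 7) (eps 7 (FlatI (Var 2))) (eps 7 (FlatI (Var 0))))
           (App
             (Lam (isCrisplyDiscrete (Id (Var 9) (pt 8 (Var 3)) (pt 8 (Var 1))))
               (Split (center_path 10 (FlatI (Var 5)) (FlatI (Var 3)) (Var 2))
                 (Split (center_path 12 (FlatI (Var 7)) (FlatI (Var 5)) (Var 4))
                   (app
                     (FlatE
                       (arrow
                         (Id (Id (Var 15) (pt 14 (Var 9)) (pt 14 (Var 7)))
                           (App (counit (Id (Var 15) (pt 14 (Var 9)) (pt 14 (Var 7))))
                                (Var 0))
                           (pt_path 13 (Var 9) (Var 7) (Var 6)))
                         (center_path 14 (FlatI (Var 9)) (FlatI (Var 7)) (Var 6)))
                       (Lam
                         (Id (Id (Var 15) (pt 14 (Var 9)) (pt 14 (Var 7)))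
                           (App (counit (Id (Var 15) (pt 14 (Var 9)) (pt 14 (Var 7))))
                                (FlatI (Var 0)))
                           (pt_path 13 (Var 9) (Var 7) (Var 6)))
                         (transport
                           (Id (fiber 16 (Var 9)) (Pair (FlatI (Var 9)) (Refl (Var 9)))
                              (Pair (FlatI (Var 11)) (Var 0)))
                           (lift 14 (Var 10) (Var 8)
                              (pt_path 14 (Var 10) (Var 8) (Var 7)))
                           (Var 7)
                           (app (Var 13) [Var 10; Var 8; Var 7])
                           (transport
                             (Id (fiber 16 (Var 9)) (Pair (FlatI (Var 9)) (Refl (Var 9)))
                                (Pair (FlatI (Var 11))
                                   (lift 15 (Var 11) (Var 9) (Var 0))))
                             (Var 1)
                             (pt_path 14 (Var 10) (Var 8) (Var 7))
                             (Var 0)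
                             (crisp_center_path 14 (Var 10) (Var 8)
                                (lift 14 (Var 10) (Var 8) (Var 1))))))
                       (App (Var 1) (pt_path 12 (Var 8) (Var 6) (Var 5))))
                     [App (Var 0) (pt_path 12 (Var 8) (Var 6) (Var 5))])
                   (Var 1))
                 (Var 0)))
             (* By the computation rule of [FlatE], the hypothesis at these two points says that
                [pt c = pt d] is crisply discrete. *)
             (app (Var 5) [FlatI (pt 8 (Var 3)); FlatI (pt 8 (Var 1))])))
         (Var 0)))
       (Var 0))))).
Qed.

(* Over [eps w], two elements are both equal to [(w, refl)]; for [b] arbitrary, an
   element [(w, q)] of the fiber lets us transport that along [q : eps w = b]. *)
Lemma prop_fibers (i : nat) : exists t,
  lift_ctx i ⊢ t ∈ arrow (CenterPaths 1) (PropFibers 1).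
Proof.
  inhabit i
   (Lam (CenterPaths 1) (App
     (Lam (PropFibersOverCounit 2)
       (Lam (baut 3) (Lam (fiber 4 (Var 0)) (Lam (fiber 5 (Var 1))
         (app
           (Split (isProp (fiber 7 (Var 3)))
             (transport (isProp (fiber 9 (Var 0))) (eps 8 (Var 1)) (Var 4) (Var 0)
                (App (Var 5) (Var 1)))
             (Var 0))
           [Var 1; Var 0])))))
     (Lam (Flat (baut 2)) (Lam (fiber 3 (eps 3 (Var 0))) (Lam (fiber 4 (eps 4 (Var 1)))
       (let center_path_to u :=
          Split (Id (fiber 6 (eps 6 (Var 3))) (Pair (Var 3) (Refl (eps 6 (Var 3)))) (Var 0))
                (app (Var 5) [Var 1; Var 4; Var 0]) u in
        transport (Id (fiber 6 (eps 6 (Var 3))) (Var 0) (Var 1))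
          (Pair (Var 2) (Refl (eps 5 (Var 2)))) (Var 1)
          (center_path_to (Var 1)) (center_path_to (Var 0)))))))).
Qed.

Lemma fiber_section (i : nat) : exists t,
  lift_ctx i ⊢ t ∈ arrow (PropFibers 1) (FiberSection 1).
Proof.
  inhabit i
   (Lam (PropFibers 1) (Lam (baut 2) (Split (fiber 4 (Var 0))
     (TrRec (fiber 5 (Pair (Var 1) (Var 0))) (App (Var 3) (Pair (Var 1) (Var 0)))
       (Lam (Id (Var 6) (Var 5) (Var 1))
         (Pair (FlatI (Pair (Var 6) (TrI (Refl (Var 6)))))
            (* [Var 5] is the lifting hypothesis [m]. It allows arbitrary truncation witnesses, so a
               path [x = y] suffices. *)
            (app (Var 5)
               [Pair (Var 6) (TrI (Refl (Var 6))); Pair (Var 2) (Var 1); Var 0])))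
       (Var 0))
     (Var 0)))).
Qed.

(** * Discreteness *)

(** The section gives both inverses. For the left one, its value at [eps v] and [(v, refl)] lie in
    the same fiber, a proposition, so their first components agree. *)
Lemma crisply_discrete (i : nat) : exists t,
  lift_ctx i ⊢ t ∈ arrows [PropFibers 1; FiberSection 1] (isCrisplyDiscrete (baut 1)).
Proof.
  inhabit i
   (Lam (PropFibers 1) (Lam (FiberSection 2)
     (Pair
       (Pair (Lam (baut 3) (fiber_fst 4 (App (Var 1) (Var 0))))
             (Lam (baut 3) (fiber_snd 4 (Var 0) (App (Var 1) (Var 0)))))
       (Pair (Lam (baut 3) (fiber_fst 4 (App (Var 1) (Var 0))))
             (Lam (Flat (baut 3))
               (J (Id (Flat (baut 7)) (fiber_fst 7 (Var 2)) (fiber_fst 7 (Var 1)))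
                 (Refl (fiber_fst 5 (Var 0)))
                 (App (Var 1) (eps 4 (Var 0)))
                 (Pair (Var 0) (Refl (eps 4 (Var 0))))
                 (app (Var 2) [eps 4 (Var 0); App (Var 1) (eps 4 (Var 0));
                               Pair (Var 0) (Refl (eps 4 (Var 0)))]))))))).
Qed.

(** [RFlat] applies because [baut 1] mentions only the crisp variables [X] and [x]. *)
Lemma both_discrete (i : nat) : exists t,
  lift_ctx i ⊢ t ∈ arrow (isCrisplyDiscrete (baut 1)) (bothDiscrete 1).
Proof.
  inhabit i
   (Lam (isCrisplyDiscrete (baut 1))
     (Pair (Var 0)
       (App (Split (arrow (isCrisplyDiscrete (baut 3)) (isDiscrete (baut 3))) (Var 1)
               (RFlat (baut 2)))
          (Var 0)))).
Qed.

(** The pieces enter as variables, so the composite is checked without inspecting the terms that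
    inhabit them. *)
Lemma combine (i : nat) : exists t,
  lift_ctx i ⊢ t ∈
    arrows [LiftPtPath 0; arrows [LiftPtPath 0; lcd i 1] (CenterPaths 1);
            arrow (CenterPaths 1) (PropFibers 1);
            arrow (PropFibers 1) (FiberSection 1);
            arrows [PropFibers 1; FiberSection 1] (isCrisplyDiscrete (baut 1));
            arrow (isCrisplyDiscrete (baut 1)) (bothDiscrete 1); lcd i 1]
      (bothDiscrete 1).
Proof.
  inhabit i
   (Lam (LiftPtPath 0) (Lam (arrows [LiftPtPath 1; lcd i 2] (CenterPaths 2))
     (Lam (arrow (CenterPaths 3) (PropFibers 3))
     (Lam (arrow (PropFibers 4) (FiberSection 4))
     (Lam (arrows [PropFibers 5; FiberSection 5] (isCrisplyDiscrete (baut 5)))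
     (Lam (arrow (isCrisplyDiscrete (baut 6)) (bothDiscrete 6))
     (Lam (lcd i 7)
       (App
         (Lam (PropFibers 8) (App (Var 2) (app (Var 3) [Var 0; App (Var 4) (Var 0)])))
         (App (Var 4) (app (Var 5) [Var 6; Var 0])))))))))).
Qed.

Lemma arrow_app G A B f a :
  G ⊢ f ∈ arrow A B -> G ⊢ a ∈ A -> (wk 1 B)[[a ⋅ vars 0]] = B -> G ⊢ App f a ∈ B.
Proof. intros Hf Ha E; eapply eq_type; [exact (e_app _ _ _ _ _ _ _ Hf Ha) | exact E]. Qed.

Theorem theorem5p9 (i : nat) :
  exists t : tm,
    [] ,,♭ Univ i ,,♭ Var 0 ⊢ t ∈
      arrow (isLocallyCrisplyDiscrete i (Var 1))
        (prod (isCrisplyDiscrete (BAut (Var 1) (Var 0)))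
              (isDiscrete (BAut (Var 1) (Var 0)))).
Proof.
  destruct (lift_paths i) as [m Hm], (combine i) as [t Ht],
    (lift_pt_path i) as [t1 H1], (center_paths i) as [t2 H2], (prop_fibers i) as [t3 H3],
    (fiber_section i) as [t4 H4], (crisply_discrete i) as [t5 H5],
    (both_discrete i) as [t6 H6].
  (* [FlatE] at [FlatI m] discharges the hypothesis [LiftPaths 0]. It must be a crisp variable, as
     [center_paths] uses lifts under [SharpE]. *)
  exists (FlatE (arrow (lcd i 1) (bothDiscrete 1)) (app t [t1; t2; t3; t4; t5; t6])
            (FlatI m)).
  eapply eq_type; [apply (flatE_rule (S i)) with (A := LiftPaths 0) | reflexivity].
  - apply e_flatI; exact Hm.
  - normalize; check (S i).
  - pose proof (arrow_app _ _ _ _ _ Ht H1 eq_refl) as K.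
    apply arrow_app with (2 := H2) in K; [ | reflexivity].
    apply arrow_app with (2 := H3) in K; [ | reflexivity].
    apply arrow_app with (2 := H4) in K; [ | reflexivity].
    apply arrow_app with (2 := H5) in K; [ | reflexivity].
    apply arrow_app with (2 := H6) in K; [ | reflexivity].
    exact K.
Qed.
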